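(* Let $0<L_1\le L_2\le\dots\le L_n$ and fix a minibatch size $b\in(0,n]$. Let $k$ be the largest integer (in $\{1,\dots,n\}$) satisfying $0<b+k-n\le\frac{\sum_{i=1}^kL_i}{L_k}$ (for instance, $k=n-b+1$ satisfies this condition), and define $$p_i=\begin{cases}(b+k-n)\dfrac{L_i}{\sum_{j=1}^kL_j}, & i\le k,\\ 1,& i>k.\end{cases}\qquad(\ast)$$ (Usually, if the $L_i$'s are not too different, $k=O(n)$; for instance, if $bL_n\le\sum_{i=1}^nL_i$, then $k=n$.) (1) Among all proper samplings $S$ with $\mathrm{E}|S|=b$ and all $v\in\mathbb{R}^n$ satisfying $\mathbf{P}-pp^\top\preceq\mathrm{Diag}(p_1v_1,\dots,p_nv_n)$, the quantity $\alpha$ (defined in the context) is minimized by the independent sampling $S^*$ with probabilities $(\ast)$, for which $v_i=1-p_i$. (2) If $S$ is chosen to be the approximate independent sampling $S^a$, then $\alpha$ is minimized for the probabilities $(\ast)$. The value of $\alpha$ for the probabilities $(\ast)$ is $$\alpha=\left(\frac{b\left(\sum_{i=1}^kL_i\right)^2}{(b+k-n)n^2}-\frac{bs}{n^2}\sum_{i=1}^kL_i^2\right)\Big/\bar L^2,$$ where $s=1$ for $S^*$ and $s=1-\frac{k-a}{a(k-1)}$ for $S^a$, with $a=\lceil k\max_{i\le k}p_i\rceil$. (3) Moreover, if $bL_n\le\sum_{i=1}^nL_i$, then $k=n$, and thus $$\alpha_{S^*}=1-b\,\frac{\sum_{i=1}^nL_i^2}{\left(\sum_{i=1}^nL_i\right)^2}\le\frac{n-b}{n},\qquad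 \alpha_{S^u}=(n-b)\frac{n}{n-1}\,\frac{\sum_{i=1}^nL_i^2}{\left(\sum_{i=1}^nL_i\right)^2},$$ where $\alpha_{S^*}$ is the value of $\alpha$ for $S^*$ with probabilities $(\ast)$ and $\alpha_{S^u}$ is its value for the standard uniform minibatch sampling $S^u$ of size $b$. (4) In the special case when all $L_i$ are the same, $\alpha_{S^*}=\frac{n-b}{n}$ and $\alpha_{S^u}=\frac{n-b}{n-1}$.
   Context: A sampling $S$ is a random subset of $[n]=\{1,\dots,n\}$; $\mathbf{P}_{ij}=\mathrm{Prob}(\{i,j\}\subseteq S)$ is its probability matrix, $p_i=\mathrm{Prob}(i\in S)$, $p=(p_1,\dots,p_n)^\top$; $S$ is proper if $p_i>0$ for all $i$; its minibatch size is $b=\mathrm{E}|S|=\sum_ip_i$. The numbers $L_i$ are smoothness constants of functions $f_i:\mathbb{R}^d\to\mathbb{R}$, i.e. $\|\nabla f_i(x)-\nabla f_i(y)\|\le L_i\|x-y\|$ for all $x,y$, and $\bar L=\frac1n\sum_{i=1}^nL_i$. For a proper sampling $S$ and $v\in\mathbb{R}^n$ with $\mathbf{P}-pp^\top\preceq\mathrm{Diag}(p_1v_1,\dots,p_nv_n)$, define $$K=\frac{b}{n^2}\sum_{i=1}^n\frac{v_iL_i^2}{p_i},\qquad\alpha=\frac{K}{\bar L^2}.$$ Samplings, with the vector $v$ used for each: - Standard uniform minibatch sampling $S^u$: $S$ is chosen uniformly at random from all subsets of $[n]$ of cardinality $b$; $v_i=\frac{n-b}{n-1}$. - Independent sampling: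 each $i$ is included in $S$ independently with probability $p_i>0$; $v_i=1-p_i$. - Approximate independent sampling with probabilities $p_1\le\dots\le p_n$: let $k=|\{i:p_i<1\}|=\max\{i:p_i<1\}$ and $a=\lceil k\max_{i\le k}p_i\rceil$; choose $S'\subseteq\{1,\dots,k\}$ of cardinality $a$ uniformly at random, then include each $i\in S'$ in $S$ independently with probability $kp_i/a$; the elements $i>k$ (with $p_i=1$) are always included. Here $v_i=1-p_i\left(1-\frac{k-a}{a(k-1)}\right)$ for $i\le k$ and $v_i=0$ for $i>k$. $S^*$ and $S^a$ denote the independent and the approximate independent sampling, respectively.
   Formalization: In (2), minimality for S^a is only among probabilities whose own s is at most the s of (∗) (false otherwise, as a jumps), and the value of α for S^a uses k=|{i: p_i<1}|, which is the cutoff k when p_k<1 (the formula with the cutoff can fail if p_k=1). *)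

(* Defs.v *)
(* MathComp, with the reals taken to be an arbitrary [R : realType]. *)
From HB Require Import structures.
From mathcomp Require Import all_boot all_order all_algebra.
From mathcomp Require Import reals.

Set Implicit Arguments.
Unset Strict Implicit.
Unset Printing Implicit Defensive.

Import Order.TTheory GRing.Theory Num.Theory.
Local Open Scope ring_scope.

(* The ground set {1, ..., n} is represented by 'I_n, so the element written
   i in the mathematics is the ordinal of value i - 1.  A sampling (a random
   subset of the ground set) is given by its law S, where S A is the
   probability that the random set equals A. *)

Section Samplings.
Variables (R : realType) (n : nat).
Implicit Types (S : {set 'I_n} -> R) (L p v r : 'I_n -> R) (b : R).

Definition is_sampling S : Prop :=
  (forall A, 0 <= S A) /\ \sum_A S A = 1.

Definition Prob S (E : pred {set 'I_n}) : R := \sum_(A | E A) S A.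

Definition marginal S (i : 'I_n) : R := Prob S (fun A => i \in A).

Definition proper S : Prop := forall i, 0 < marginal S i.

Definition minibatch S : R := \sum_A S A * #|A|%:R.

Definition prob_mx S : 'M[R]_n :=
  \matrix_(i, j) Prob S (fun A => [set i; j] \subset A).

Definition marginal_col S : 'cV[R]_n := \col_i marginal S i.

Definition loewner_le (M N : 'M[R]_n) : Prop :=
  (N - M)^T = N - M /\ forall x : 'cV[R]_n, 0 <= (x^T *m (N - M) *m x) 0 0.

Definition eso S v : Prop :=
  loewner_le (prob_mx S - marginal_col S *m (marginal_col S)^T)
             (diag_mx (\row_i (marginal S i * v i))).

Definition admissible b S v : Prop :=
  [/\ is_sampling S, proper S, minibatch S = b & eso S v].

Definition Lbar L : R := (\sum_i L i) / n%:R.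

Definition Kconst L S v : R :=
  minibatch S / n%:R ^+ 2 * \sum_i v i * L i ^+ 2 / marginal S i.

Definition alpha L S v : R := Kconst L S v / Lbar L ^+ 2.

Definition unif_sampling (m : nat) (A : {set 'I_n}) : R :=
  if #|A| == m then ('C(n, m)%:R)^-1 else 0.

(* For n = 1 the quotient is 0 / 0 = 0, the right value: S is then the whole
   ground set and has no variance. *)
Definition unif_v (m : nat) : 'I_n -> R :=
  fun=> (n%:R - m%:R) / (n%:R - 1).

Definition indep_sampling p (A : {set 'I_n}) : R :=
  \prod_i (if i \in A then p i else 1 - p i).

Definition indep_v p : 'I_n -> R := fun i => 1 - p i.

Definition approx_k p : nat := #|[set i | p i < 1]|.

Definition approx_a p : nat :=
  absz (Num.ceil ((approx_k p)%:R
                  * \big[Num.max/0]_(i < n | (i < approx_k p)%N) p i)).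

(* Inclusion probabilities in the second stage, given the outcome T of the
   first one. *)
Definition approx_incl p (T : {set 'I_n}) : 'I_n -> R := fun i =>
  if (i < approx_k p)%N
  then if i \in T then (approx_k p)%:R * p i / (approx_a p)%:R else 0
  else 1.

Definition approx_sampling p (A : {set 'I_n}) : R :=
  \sum_(T : {set 'I_n} |
         (T \subset [set i : 'I_n | (i < approx_k p)%N])
         && (#|T| == approx_a p))
     ('C(approx_k p, approx_a p)%:R)^-1 * indep_sampling (approx_incl p T) A.

(* If approx_k p is 1 the quotient is 0 / 0 = 0, so that approx_s p = 1: this
   is the right value, as the sampling then coincides with the independent
   one.  The same holds if approx_k p is 0 (all p i equal to 1). *)
Definition approx_s p : R :=
  1 - ((approx_k p)%:R - (approx_a p)%:R)
      / ((approx_a p)%:R * ((approx_k p)%:R - 1)).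

Definition approx_v p : 'I_n -> R := fun i =>
  if (i < approx_k p)%N then 1 - p i * approx_s p else 0.

Definition sorted_probs b p : Prop :=
  [/\ forall i, 0 < p i <= 1,
      {homo p : i j / (i <= j)%N >-> i <= j}
    & \sum_i p i = b].

(* The cutoff k of the mathematics, an element of {1, ..., n}, is represented
   by the ordinal k of L_k, so that its numerical value is k.+1. *)
Definition cutoff L b (k : 'I_n) : Prop :=
  0 < b + k.+1%:R - n%:R <= (\sum_(i < n | (i <= k)%N) L i) / L k.

Definition largest_cutoff L b (k : 'I_n) : Prop :=
  cutoff L b k /\ forall j, cutoff L b j -> (j <= k)%N.

Definition opt_probs L b (k : 'I_n) : 'I_n -> R := fun i =>
  if (i <= k)%N
  then (b + k.+1%:R - n%:R) * (L i / \sum_(j < n | (j <= k)%N) L j)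
  else 1.

Definition alpha_value L b (k : nat) (s : R) : R :=
  (b * (\sum_(i < n | (i < k)%N) L i) ^+ 2 / ((b + k%:R - n%:R) * n%:R ^+ 2)
   - b * s / n%:R ^+ 2 * \sum_(i < n | (i < k)%N) L i ^+ 2)
  / Lbar L ^+ 2.

End Samplings.

Arguments unif_sampling R n m A : clear implicits.
Arguments unif_v R n m _ : clear implicits.

(* Main.v *)
Require Import Defs.
From HB Require Import structures.
From mathcomp Require Import all_boot all_order all_algebra.
From mathcomp Require Import reals ring lra.

Set Implicit Arguments.
Unset Strict Implicit.
Unset Printing Implicit Defensive.

Import Order.TTheory GRing.Theory Num.Theory.
Local Open Scope ring_scope.

(** Admissibility.  For each of the three samplings, the matrix
    Diag(p_i v_i) - (P - p p^T) turns out to be d * w w^T with d >= 0, hence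
    positive semidefinite ([eso_rank1]).  For the independent sampling the
    pair probabilities are p_i p_j and d = 0.  For the uniform and the
    approximate independent sampling, a uniformly drawn set of size a in a set
    of size k contains a given pair with probability a(a-1)/(k(k-1))
    ([draw_avg_mem2]), which makes pairs slightly less likely than under
    independence, by the same relative amount for all pairs of the k-set; for
    the approximate independent sampling this amount is d = 1 - s, and w_i is
    p_i if p_i < 1 and 0 if p_i = 1.

    Optimality.  Reading the matrix inequality on the diagonal gives
    v_i >= 1 - p_i ([eso_lower_bound]), so alpha is at least its value for the
    independent sampling with the same marginals, and one has to minimize
    sum_i L_i^2 / p_i subject to sum_i p_i = b and 0 < p_i <= 1.  This is a
    convex problem whose solution is p_i = min(1, L_i / c), the level c being
    fixed by the budget b.  The cutoff inequality for k gives L_i <= c for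
    i <= k, and its failure for k + 1 gives c <= L_i for i > k, so the
    probabilities of the statement have this form ([opt_probs_level]).  Optimality follows from the
    tangent inequality [level_prob_tangent] with Lagrange multiplier c^2,
    summed over i ([ler_sum_multiplier]).

    For the approximate independent sampling there is an extra term
    (1 - s) sum_{i : p_i < 1} L_i^2, which also depends on the probabilities,
    through s and through the index set.  A competitor q with smaller s may
    still have fewer indices with q_i < 1.  An index with p_i < 1 = q_i loses
    at most (1 - s) L_i^2 there, but the slack in the tangent inequality is
    L_i^2 (1/p_i - 1)^2 ([level_prob_gap]), and this is enough because
    p_i <= a / k, with k and a the sizes used by the sampling for p, forces
    1 - s <= (1/p_i - 1)^2 ([one_sub_approx_s_le]).

    The closed forms are a direct computation ([alpha_valueE]); the
    bound alpha <= (n - b) / n is the Cauchy-Schwarz inequality ([sum_sqr_ratio_ge]). *)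

(** * Finite sets *)

(** Removing B is a bijection onto the (a - #|B|)-subsets of K :\: B. *)
Lemma card_draws_above (T : finType) (B K : {set T}) (a : nat) :
  B \subset K -> (#|B| <= a)%N ->
  #|[set A : {set T} | [&& A \subset K, #|A| == a & B \subset A]]|
    = 'C(#|K| - #|B|, a - #|B|).
Proof.
move=> BK Ba; rewrite -(cardsDS BK) -cards_draws.
rewrite -[RHS](@card_in_imset _ _ (fun A => A :|: B)) => [|A A']; last first.
  rewrite !inE => /andP[+ _] /andP[+ _]; rewrite !subsetD.
  move=> /andP[_ dA] /andP[_ dA'] /(congr1 (fun X => X :\: B)).
  rewrite !setDUl setDv !setU0.
  by rewrite (setDidPl dA) (setDidPl dA').
congr #|pred_of_set _|; apply/setP => A; rewrite inE; apply/and3P/imsetP.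
  case=> AK /eqP cA BA; exists (A :\: B); last first.
    by rewrite -{1}(setID A B) (setIidPr BA) setUC.
  by rewrite inE setSD //= cardsDS // cA.
case=> A'; rewrite inE subsetD => /andP[/andP[A'K dA'] /eqP cA'] ->.
split; [by rewrite subUset A'K | | exact: subsetUr].
by rewrite cardsU disjoint_setI0 // cards0 subn0 cA' subnK.
Qed.

Lemma cards_ltn (n m : nat) : (m <= n)%N -> #|[set i : 'I_n | (i < m)%N]| = m.
Proof.
by move=> mn; rewrite cardsE -sum1_card (big_ord_narrow mn) big_const_ord iter_addn_0 mul1n.
Qed.

Lemma down_closed_ltn (n : nat) (A : {set 'I_n}) :
  (forall i j : 'I_n, (i <= j)%N -> j \in A -> i \in A) ->
  forall i, (i \in A) = (i < #|A|)%N.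
Proof.
move=> downA i; apply/idP/idP => [iA | ].
  rewrite -[i.+1](cards_ltn (ltn_ord i)); apply/subset_leq_card/subsetP => j.
  by rewrite inE ltnS => /downA; apply.
apply: contraLR => iA; rewrite -leqNgt -[X in (_ <= X)%N](cards_ltn (ltnW (ltn_ord i))).
apply/subset_leq_card/subsetP => j jA; rewrite inE ltnNge.
by apply: contra iA => /downA; apply.
Qed.

(** * Marginals and the matrix inequality *)

Section Samplings.
Variables (R : realType) (n : nat).
Implicit Types (S : {set 'I_n} -> R) (L p v r : 'I_n -> R) (b : R).

Lemma minibatch_marginal S : minibatch S = \sum_i marginal S i.
Proof.
rewrite /minibatch /marginal /Prob.
under [RHS]eq_bigr do rewrite big_mkcond.
rewrite exchange_big; apply: eq_bigr => A _.
by rewrite -big_mkcond sumr_const mulr_natr.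
Qed.

Lemma prob_mxE S i j : prob_mx S i j = Prob S (fun A => (i \in A) && (j \in A)).
Proof.
by rewrite mxE; apply: eq_bigl => A; rewrite subUset !sub1set.
Qed.

Lemma marginal_le1 S i : is_sampling S -> marginal S i <= 1.
Proof.
case=> S0 <-; rewrite [leRHS](bigID (fun A : {set 'I_n} => i \in A)) /= lerDl.
exact: sumr_ge0.
Qed.

Definition eso_mx S v : 'M[R]_n :=
  diag_mx (\row_i (marginal S i * v i))
  - (prob_mx S - marginal_col S *m (marginal_col S)^T).

Lemma eso_mxE S v i j :
  eso_mx S v i j = (marginal S i * v i) *+ (i == j)
    - (Prob S (fun A => (i \in A) && (j \in A)) - marginal S i * marginal S j).
Proof.
by rewrite /eso_mx !mxE -prob_mxE mxE big_ord1 !mxE.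
Qed.

Lemma prob_mx_diag S i :
  Prob S (fun A => (i \in A) && (i \in A)) = marginal S i.
Proof. by apply: eq_bigl => A; rewrite andbb. Qed.

(** The diagonal of a positive semidefinite matrix is nonnegative, and the
    diagonal entry of P - p p^T is p_i - p_i^2. *)
Lemma eso_lower_bound S v i : eso S v -> 0 < marginal S i -> 1 - marginal S i <= v i.
Proof.
case=> _ /(_ (delta_mx i 0)); rewrite -/(eso_mx S v) trmx_delta -rowE -colE.
rewrite [leRHS]mxE [leRHS]mxE eso_mxE eqxx mulr1n prob_mx_diag => psd p0.
rewrite -(ler_pM2l p0) mulrBr mulr1; lra.
Qed.

(** The hypotheses state, on and off the diagonal, that
    Diag(p_i v_i) - (P - p p^T) = d * w w^T. *)
Lemma eso_rank1 S v d (w : 'I_n -> R) : 0 <= d ->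
  (forall i, marginal S i * v i - (marginal S i - marginal S i ^+ 2) = d * w i ^+ 2) ->
  (forall i j, i != j ->
     marginal S i * marginal S j - Prob S (fun A => (i \in A) && (j \in A))
       = d * (w i * w j)) ->
  eso S v.
Proof.
move=> d0 dg odg.
have ME : eso_mx S v = d *: ((\col_i w i) *m (\col_i w i)^T).
  apply/matrixP => i j; rewrite eso_mxE !mxE big_ord1 !mxE.
  have [<-|ij] := eqVneq i j; first by rewrite prob_mx_diag -expr2 -dg mulr1n; ring.
  by rewrite -odg // mulr0n; ring.
rewrite /eso /loewner_le -/(eso_mx S v) ME; split.
  by rewrite linearZ /= trmx_mul trmxK.
move=> x; rewrite -scalemxAr -scalemxAl mxE mulr_ge0 //.
set W := \col_i w i.
have -> : x^T *m (W *m W^T) *m x = (W^T *m x)^T *m (W^T *m x).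
  by rewrite trmx_mul trmxK !mulmxA.
by rewrite mxE big_ord1 mxE -expr2 sqr_ge0.
Qed.

(** * Independent sampling *)

(** Replacing 1 - r_i by 0 for i in B kills the sets that do not contain B
    and leaves the weight of the others unchanged; the total mass of the
    modified product law then factors. *)
Lemma indep_incl r (B : {set 'I_n}) :
  Prob (indep_sampling r) (fun A => B \subset A) = \prod_(i in B) r i.
Proof.
transitivity (\prod_i (r i + (if i \in B then 0 else 1 - r i))); last first.
  rewrite [RHS]big_mkcond; apply: eq_bigr => i _.
  by case: ifP => _; [rewrite addr0 | rewrite subrKC].
rewrite bigA_distr /Prob big_mkcond; apply: eq_bigr => A _.
case: ifPn => [BA | /subsetPn[i iB iA]].
  apply: eq_bigr => i _; case: ifPn => // iA.
  by case: ifP => // iB; rewrite (subsetP BA _ iB) in iA.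
by rewrite (bigD1 i) //= (negbTE iA) iB mul0r.
Qed.

Lemma indep_total r : \sum_A indep_sampling r A = 1.
Proof.
transitivity (\prod_(j in @set0 'I_n) r j); last by rewrite big_set0.
by rewrite -indep_incl; apply: eq_bigl => A; rewrite sub0set.
Qed.

Lemma indep_sampling_ge0 r A : (forall i, 0 <= r i <= 1) ->
  0 <= indep_sampling r A.
Proof.
move=> r01; apply: prodr_ge0 => i _; have /andP[r0 r1] := r01 i.
by case: ifP; rewrite ?subr_ge0.
Qed.

Lemma indep_marginal r i : marginal (indep_sampling r) i = r i.
Proof.
transitivity (\prod_(j in [set i]) r j); last by rewrite big_set1.
by rewrite -indep_incl; apply: eq_bigl => A; rewrite sub1set.
Qed.

Lemma indep_pair r i j : i != j ->
  Prob (indep_sampling r) (fun A => (i \in A) && (j \in A)) = r i * r j.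
Proof.
move=> ij; transitivity (\prod_(l in [set i; j]) r l).
  rewrite -indep_incl; apply: eq_bigl => A.
  by rewrite subUset !sub1set.
by rewrite big_setU1 ?inE // big_set1.
Qed.

Lemma indep_admissible p b : sorted_probs b p ->
  admissible b (indep_sampling p) (indep_v p).
Proof.
case=> p01 _ sump; have p0 i : 0 < p i by case/andP: (p01 i).
split.
- split; last exact: indep_total.
  by move=> A; apply: indep_sampling_ge0 => i; case/andP: (p01 i) => /ltW->.
- by move=> i; rewrite indep_marginal.
- by rewrite minibatch_marginal (eq_bigr p) // => i _; rewrite indep_marginal.
apply: (@eso_rank1 _ _ 0 (fun=> 0)) => // [i | i j ij].
  by rewrite indep_marginal /indep_v; ring.
by rewrite !indep_marginal indep_pair //; ring.
Qed.

(** * Uniformly drawn sets and uniform sampling *)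

(** The expectation of F over the a-subsets of K.  The normalization stays
    inside the sum so that the mixture defining [approx_sampling] is an
    instance. *)
Definition draw_avg (K : {set 'I_n}) (a : nat) (F : {set 'I_n} -> R) : R :=
  \sum_(T : {set 'I_n} | (T \subset K) && (#|T| == a)) ('C(#|K|, a)%:R)^-1 * F T.

Lemma draw_avg_incl (B K : {set 'I_n}) a : B \subset K -> (#|B| <= a)%N ->
  draw_avg K a (fun T => (B \subset T)%:R)
    = 'C(#|K| - #|B|, a - #|B|)%:R / 'C(#|K|, a)%:R.
Proof.
move=> BK Ba; rewrite -(card_draws_above BK Ba) /draw_avg -mulr_sumr mulrC.
rewrite -natr_sum; congr (_%:R / _); rewrite -[RHS]sum1_card.
rewrite [RHS](eq_bigl (fun T : {set 'I_n} =>
  [&& T \subset K & #|T| == a] && (B \subset T))) => [|T]; last first.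
  by rewrite inE andbA.
by rewrite [RHS]big_mkcondr.
Qed.

Lemma eq_draw_avg K a F G : F =1 G -> draw_avg K a F = draw_avg K a G.
Proof. by move=> FG; apply: eq_bigr => T _; rewrite FG. Qed.

Lemma draw_avgZ K a c F : draw_avg K a (fun T => c * F T) = c * draw_avg K a F.
Proof. by rewrite mulr_sumr; apply: eq_bigr => T _; rewrite mulrCA. Qed.

Lemma draw_avg1 (K : {set 'I_n}) a : (a <= #|K|)%N -> draw_avg K a (fun=> 1) = 1.
Proof.
move=> aK; transitivity (draw_avg K a (fun T => (set0 \subset T)%:R)).
  by apply: eq_draw_avg => T; rewrite sub0set.
rewrite draw_avg_incl ?sub0set ?cards0 // !subn0 divff //.
by rewrite pnatr_eq0 -lt0n bin_gt0.
Qed.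

Lemma draw_avg_mem (K : {set 'I_n}) a i : (0 < a <= #|K|)%N -> i \in K ->
  draw_avg K a (fun T => (i \in T)%:R) = a%:R / #|K|%:R.
Proof.
move=> /andP[a0 aK] iK; transitivity (draw_avg K a (fun T => ([set i] \subset T)%:R)).
  by apply: eq_draw_avg => T; rewrite sub1set.
rewrite draw_avg_incl ?sub1set ?cards1 //.
have K0 : (0 < #|K|)%N by apply: leq_trans aK.
have := mul_bin_diag #|K| a.-1; rewrite prednK // !subn1 => /(congr1 (fun m => m%:R : R)).
rewrite !natrM => E; apply/eqP.
by rewrite eqr_div ?pnatr_eq0 -?lt0n ?bin_gt0 // mulrC E.
Qed.

Lemma draw_avg_mem2 (K : {set 'I_n}) a i j : (0 < a <= #|K|)%N ->
  i \in K -> j \in K -> i != j ->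
  draw_avg K a (fun T => ((i \in T) && (j \in T))%:R)
    = (a%:R * (a%:R - 1)) / (#|K|%:R * (#|K|%:R - 1)).
Proof.
move=> /andP[a0 aK] iK jK ij.
have ijK : [set i; j] \subset K by rewrite subUset !sub1set iK.
have cij : #|[set i; j]| = 2 by rewrite cards2 ij.
have K2 : (1 < #|K|)%N by have := subset_leq_card ijK; rewrite cij.
transitivity (draw_avg K a (fun T => ([set i; j] \subset T)%:R)).
  by apply: eq_draw_avg => T; rewrite subUset !sub1set.
have [a1|a2] := leqP a 1.
  (* No set of size 1 contains the pair, and the right-hand side vanishes. *)
  have -> : a = 1 by apply/eqP; rewrite eqn_leq a1.
  rewrite subrr mulr0 mul0r /draw_avg big1 // => T /andP[_ /eqP cT].
  case: (boolP (_ \subset T)) => [/subset_leq_card|]; last by rewrite mulr0.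
  by rewrite cij cT.
rewrite draw_avg_incl ?cij //.
have := mul_bin_diag #|K| a.-1; have := mul_bin_diag #|K|.-1 a.-1.-1.
have -> : (#|K| - 2 = #|K|.-1.-1)%N by rewrite subn2.
have -> : (a - 2 = a.-1.-1)%N by rewrite subn2.
rewrite !prednK //; last by rewrite -subn1 subn_gt0.
move=> /(congr1 (fun m => m%:R : R)) + /(congr1 (fun m => m%:R : R)).
rewrite !natrM -!subn1 !natrB ?(ltnW a2) ?(ltnW K2) // => E1 E2.
apply/eqP; rewrite eqr_div ?mulf_neq0 ?subr_eq0 ?eqr_nat ?pnatr_eq0 -?lt0n ?bin_gt0 //.
- by rewrite mulrC -mulrA E1 mulrCA E2; apply/eqP; ring.
- by rewrite (leq_trans a0).
- by rewrite (eqr_nat R _ 1) gtn_eqF.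
Qed.

(** The slack matrix has all its entries equal to
    d = (b/n) (n-b) / (n (n-1)). *)
Lemma unif_admissible (m : nat) b : b = m%:R -> 0 < b -> b <= n%:R ->
  admissible b (unif_sampling R n m) (unif_v R n m) /\
  marginal (unif_sampling R n m) =1 fun=> b / n%:R.
Proof.
move=> bm b0 bn.
have mn : (m <= n)%N by rewrite -(ler_nat R) -bm.
have m0 : (0 < m)%N by rewrite -(ltr_nat R) -bm.
have n0 : n%:R != 0 :> R by rewrite pnatr_eq0 -lt0n (leq_trans m0).
have cT : #|[set: 'I_n]| = n by rewrite cardsT card_ord.
have ProbE (E : pred {set 'I_n}) :
    Prob (unif_sampling R n m) E = draw_avg setT m (fun T => (E T)%:R).
  rewrite /Prob /draw_avg /unif_sampling cT big_mkcond [RHS]big_mkcond.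
  apply: eq_bigr => T _; rewrite subsetT /=.
  by case: (E T); case: (_ == m); rewrite ?mulr1 ?mulr0.
have margE i : marginal (unif_sampling R n m) i = b / n%:R.
  by rewrite /marginal ProbE draw_avg_mem ?inE // cT ?m0 // bm.
split=> //; split.
- split=> [A|]; first by rewrite /unif_sampling; case: ifP; rewrite ?invr_ge0.
  rewrite -[LHS]/(Prob (unif_sampling R n m) predT) ProbE draw_avg1 //.
  by rewrite cT.
- by move=> i; rewrite margE divr_gt0 // (lt_le_trans b0).
- rewrite minibatch_marginal (eq_bigr (fun=> b / n%:R)) // sumr_const card_ord.
  by rewrite -[_ *+ n]mulr_natr mulfVK.
pose d : R := b / n%:R * ((n%:R - b) / (n%:R * (n%:R - 1))).
have n1 : 0 <= n%:R - 1 :> R.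
  by rewrite subr_ge0 (ler_nat _ 1) (leq_trans m0).
have b1 : 1 <= b by rewrite bm (ler_nat _ 1).
apply: (@eso_rank1 _ _ d (fun=> 1)).
- by rewrite /d mulr_ge0 ?divr_ge0 ?subr_ge0 ?mulr_ge0 ?(ltW b0).
- move=> i; rewrite margE /unif_v -bm /d.
  (* For n = 1 the divisions by n - 1 yield 0; there b = 1 and all terms vanish. *)
  have [n1E|n1N] := eqVneq (n%:R - 1 : R) 0; last by field; rewrite n0 n1N.
  rewrite n1E mulr0 invr0 !(mulr0, mul0r).
  have -> : b = n%:R by apply/eqP; rewrite eq_le bn -subr_ge0; lra.
  by rewrite divff //; ring.
move=> i j ij; rewrite !margE ProbE draw_avg_mem2 ?inE // cT ?m0 // -bm /d.
(* Two distinct indices exist, so n > 1. *)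
suff n1N : n%:R - 1 != 0 :> R by field; rewrite n0 n1N.
rewrite subr_eq0 (eqr_nat R _ 1) -cT; apply/eqP => c1.
have := subset_leq_card (subsetT [set i; j]).
by rewrite cards2 ij c1.
Qed.

(** * Approximate independent sampling *)

Section ApproxSampling.
Variables (p : 'I_n -> R) (b : R).
Hypothesis p_sorted : sorted_probs b p.

Let p0 i : 0 < p i. Proof. by case: p_sorted => /(_ i)/andP[]. Qed.
Let p1 i : p i <= 1. Proof. by case: p_sorted => /(_ i)/andP[]. Qed.

Let k := approx_k p.
Let a := approx_a p.
Let K := [set i : 'I_n | (i < k)%N].

(** Since p is sorted, the indices with p_i < 1 form an initial segment, so
    their number is also the first index past them. *)
Lemma ltn_approx_k (i : 'I_n) : (i < k)%N = (p i < 1).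
Proof.
rewrite -(@down_closed_ltn _ [set i | p i < 1]) ?inE // => {}i j ij.
by rewrite !inE; apply: le_lt_trans; case: p_sorted => _ /(_ _ _ ij).
Qed.

Lemma approx_k_le : (k <= n)%N.
Proof. by rewrite -[leqRHS]card_ord max_card. Qed.

Let cK : #|K| = k. Proof. by rewrite cards_ltn ?approx_k_le. Qed.

Let pmax : R := \big[Num.max/0]_(i < n | (i < k)%N) p i.
Let pmax0 : 0 <= pmax. Proof. exact: bigmax_ge_id. Qed.

Let a_ceil : (a : int) = Num.ceil (k%:R * pmax).
Proof.
have kp0 : 0 <= k%:R * pmax by rewrite mulr_ge0.
by rewrite /a /approx_a gez0_abs // ceil_ge0 (lt_le_trans _ kp0) // ltrN10.
Qed.

Lemma approx_a_ge (i : 'I_n) : (i < k)%N -> k%:R * p i <= a%:R.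
Proof.
move=> ik; rewrite -[a%:R]/(a%:Z%:~R) a_ceil; apply: le_trans (ceil_ge _).
by rewrite ler_wpM2l //; apply: le_bigmax_cond.
Qed.

Lemma approx_a_le : (a <= k)%N.
Proof.
rewrite -lez_nat a_ceil ceil_le_int -[leRHS]mulr1 ler_wpM2l //.
by apply/bigmax_leP; split.
Qed.

Lemma approx_a_gt0 (i : 'I_n) : (i < k)%N -> (0 < a)%N.
Proof.
move=> ik; rewrite -(ltr_nat R) (lt_le_trans _ (approx_a_ge ik)) //.
by rewrite mulr_gt0 // ltr0n (leq_trans _ ik).
Qed.

Lemma approx_k_neq1 (i j : 'I_n) : i != j -> (i < k)%N -> (j < k)%N ->
  k%:R - 1 != 0 :> R.
Proof.
move=> ij ik jk; rewrite subr_eq0 (eqr_nat R _ 1) -cK; apply/eqP => c1.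
have := @subset_leq_card _ [set i; j] K.
by rewrite subUset !sub1set !inE ik jk cards2 ij c1 => /(_ isT).
Qed.

Lemma Prob_approx E : Prob (approx_sampling p) E
  = draw_avg K a (fun T => Prob (indep_sampling (approx_incl p T)) E).
Proof.
rewrite /Prob exchange_big /= /draw_avg cK.
by apply: eq_bigr => T _; rewrite mulr_sumr.
Qed.

Lemma approx_marginal : marginal (approx_sampling p) =1 p.
Proof.
move=> i; rewrite /marginal Prob_approx.
under eq_draw_avg do rewrite -/(marginal _ _) indep_marginal /approx_incl.
case: (ltnP i k) => ik; last first.
  rewrite /= draw_avg1 ?cK ?approx_a_le //.
  by apply/eqP; rewrite eq_le p1 leNgt -ltn_approx_k ltnNge ik.
transitivity (draw_avg K a (fun T => k%:R * p i / a%:R * (i \in T)%:R)).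
  by apply: eq_draw_avg => T; case: (i \in T); rewrite ?mulr1 ?mulr0.
have a0 := approx_a_gt0 ik.
rewrite draw_avgZ draw_avg_mem ?inE ?cK ?a0 ?approx_a_le //.
by field; rewrite !pnatr_eq0 -!lt0n a0 (leq_trans _ ik).
Qed.

(** Given the first stage the inclusions are independent, so only the joint
    law of the two memberships in the drawn set matters; an index i >= k has
    p_i = 1 and is independent of everything. *)
Lemma approx_pair i j : i != j ->
  Prob (approx_sampling p) (fun A => (i \in A) && (j \in A))
    = p i * p j * (if (i < k)%N && (j < k)%N
                   then k%:R * (a%:R - 1) / (a%:R * (k%:R - 1)) else 1).
Proof.
move=> ij; rewrite Prob_approx.
under eq_draw_avg do rewrite indep_pair //.
have margE l : draw_avg K a (fun T => approx_incl p T l) = p l.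
  rewrite -[RHS]approx_marginal /marginal Prob_approx; apply: eq_draw_avg => T.
  by rewrite -/(marginal _ _) indep_marginal.
have inclN (l : 'I_n) T : ~~ (l < k)%N -> approx_incl p T l = p l.
  rewrite /approx_incl -/k => /[dup] lk /negbTE->.
  by apply/eqP; rewrite eq_le p1 leNgt -ltn_approx_k lk.
case: (boolP (j < k)%N) => jk; last first.
  rewrite andbF mulr1; under eq_draw_avg do rewrite (inclN j) // mulrC.
  by rewrite draw_avgZ margE mulrC.
case: (boolP (i < k)%N) => ik; last first.
  by rewrite mulr1; under eq_draw_avg do rewrite (inclN i) //; rewrite draw_avgZ margE.
have a0 := approx_a_gt0 ik.
transitivity (draw_avg K a (fun T => (k%:R / a%:R) ^+ 2 * (p i * p j)
   * ((i \in T) && (j \in T))%:R)).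
  apply: eq_draw_avg => T; rewrite /approx_incl -/k -/a ik jk.
  by case: (i \in T); case: (j \in T) => /=; ring.
rewrite draw_avgZ draw_avg_mem2 ?inE ?cK ?a0 ?approx_a_le //.
have k1 := approx_k_neq1 ij ik jk.
by rewrite /=; field; rewrite !pnatr_eq0 -!lt0n a0 (leq_trans _ ik) // k1.
Qed.

Lemma one_sub_approx_s_ge0 : 0 <= 1 - approx_s p.
Proof.
rewrite subKr -/k -/a.
have ak := approx_a_le.
case: (posnP k) => [k0|k0].
  move: ak; rewrite k0 leqn0 => /eqP->; by rewrite subrr mul0r.
by rewrite divr_ge0 ?mulr_ge0 ?subr_ge0 ?ler_nat // (ler_nat R 1).
Qed.

Lemma approx_admissible : admissible b (approx_sampling p) (approx_v p).
Proof.
split.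
- split=> [A|].
    apply: sumr_ge0 => T _; rewrite mulr_ge0 ?invr_ge0 //.
    apply: indep_sampling_ge0 => i; rewrite /approx_incl.
    case: ifP => ik; last by rewrite ler01 lexx.
    case: ifP => _; last by rewrite lexx ler01.
    have a0 := approx_a_gt0 ik.
    rewrite divr_ge0 ?mulr_ge0 ?(ltW (p0 i)) //= ler_pdivrMr ?ltr0n // mul1r.
    exact: approx_a_ge.
  rewrite -[LHS]/(Prob (approx_sampling p) predT) Prob_approx.
  by under eq_draw_avg do rewrite [Prob _ _]indep_total; rewrite draw_avg1 ?cK ?approx_a_le.
- by move=> i; rewrite approx_marginal.
- rewrite minibatch_marginal (eq_bigr _ (fun i _ => approx_marginal i)).
  by case: p_sorted.
apply: (@eso_rank1 _ _ (1 - approx_s p) (fun i : 'I_n => if (i < k)%N then p i else 0)).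
- exact: one_sub_approx_s_ge0.
- move=> i; rewrite approx_marginal /approx_v -/k.
  case: ifPn => ik; first by ring.
  suff -> : p i = 1 by ring.
  by apply/eqP; rewrite eq_le p1 leNgt -ltn_approx_k.
move=> i j ij; rewrite !approx_marginal approx_pair //.
case: (boolP (i < k)%N) => ik /=; last by ring.
case: (boolP (j < k)%N) => jk /=; last by ring.
rewrite subKr -/k -/a.
have a0 := approx_a_gt0 ik.
have k1 := approx_k_neq1 ij ik jk.
by field; rewrite pnatr_eq0 -lt0n a0 k1.
Qed.

(** What makes the optimal probabilities optimal for this sampling too.  With
    t = (k - a) / a, the bound p_i <= a / k gives t <= 1 / p_i - 1, and
    1 - s = t / (k - 1) <= t^2 because (k - a)(k - 1) >= a when a < k.  When
    a = k both 1 - s and t vanish. *)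
Lemma one_sub_approx_s_le i : p i < 1 -> 1 - approx_s p <= ((p i)^-1 - 1) ^+ 2.
Proof.
rewrite -ltn_approx_k => ik; rewrite subKr -/k -/a.
have a0 : 0 < a%:R :> R by rewrite ltr0n (approx_a_gt0 ik).
have := approx_a_le; rewrite leq_eqVlt => /orP[/eqP->|ak].
  by rewrite subrr mul0r sqr_ge0.
have k1 : 0 < k%:R - 1 :> R.
  by rewrite subr_gt0 (ltr_nat R 1) (leq_ltn_trans (approx_a_gt0 ik)).
set t : R := (k%:R - a%:R) / a%:R.
have t0 : 0 <= t by rewrite divr_ge0 ?subr_ge0 ?ler_nat ?(ltW a0) ?(ltnW ak).
have tp : t <= (p i)^-1 - 1.
  rewrite /t mulrBl divff ?gt_eqF // lerD2r.
  by rewrite ler_pdivrMr // mulrC ler_pdivlMr // approx_a_ge.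
apply: le_trans (_ : t ^+ 2 <= _); last by rewrite ler_sqr ?nnegrE // (le_trans t0).
rewrite /t invfM mulrA expr2 ler_wpM2l //.
rewrite ler_pdivlMr // mulrC ler_pdivrMr //.
have : a%:R + 1 <= k%:R :> R by rewrite natr1 ler_nat.
nra.
Qed.

End ApproxSampling.
End Samplings.

(** * The ratio of the sum of squares to the square of the sum *)

Section SumRatio.
Variables (R : realType) (n : nat) (L : 'I_n -> R).
Hypotheses (n_gt0 : (0 < n)%N) (L_gt0 : forall i, 0 < L i).

Lemma sum_L_gt0 : 0 < \sum_i L i.
Proof.
rewrite (bigD1 (Ordinal n_gt0)) //= ltr_pwDl // sumr_ge0 // => i _.
by rewrite ltW.
Qed.

(** The variance of the L_i under the uniform law is nonnegative. *)
Lemma sum_sqr_ratio_ge : n%:R^-1 <= (\sum_i L i ^+ 2) / (\sum_i L i) ^+ 2.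
Proof.
have := sum_L_gt0; set A := \sum_i L i => A0.
have nR : 0 < n%:R :> R by rewrite ltr0n.
rewrite ler_pdivlMr ?exprn_gt0 // -subr_ge0.
have -> : \sum_i L i ^+ 2 - n%:R^-1 * A ^+ 2 = \sum_i (L i - A / n%:R) ^+ 2.
  pose m := A / n%:R.
  rewrite [RHS](eq_bigr (fun i => L i ^+ 2 + (- (2 * m) * L i + m ^+ 2))); last first.
    by move=> i _; rewrite -/m; ring.
  rewrite !big_split /= -mulr_sumr sumr_const card_ord -mulr_natl -/A /m.
  by field; rewrite gt_eqF.
by apply: sumr_ge0 => i _; apply: sqr_ge0.
Qed.

Lemma sum_sqr_ratio_const : (forall i j, L i = L j) ->
  (\sum_i L i ^+ 2) / (\sum_i L i) ^+ 2 = n%:R^-1.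
Proof.
move=> Lc; set x := L (Ordinal n_gt0).
have x0 : x != 0 by rewrite gt_eqF ?L_gt0.
rewrite (eq_bigr (fun=> x ^+ 2)) => [|i _]; last by rewrite (Lc i (Ordinal n_gt0)).
rewrite [X in _ / X ^+ 2](eq_bigr (fun=> x)) => [|i _]; last exact: Lc.
rewrite !sumr_const card_ord -[x ^+ 2 *+ n]mulr_natr -[x *+ n]mulr_natr.
by field; rewrite x0 gt_eqF // ltr0n.
Qed.

End SumRatio.

(** * Minimizing the sum of L_i^2 / p_i under a budget *)

Section Optimization.
Variable R : realType.

(** Weak Lagrangian duality: under equal budgets the multiplier terms cancel. *)
Lemma ler_sum_multiplier (I : finType) (F G p q : I -> R) (c : R) :
  \sum_i p i = \sum_i q i ->
  (forall i, F i + c * (p i - q i) <= G i) -> \sum_i F i <= \sum_i G i.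
Proof.
move=> pq FG; have : \sum_i (F i + c * (p i - q i)) <= \sum_i G i.
  exact: ler_sum.
by rewrite big_split /= -mulr_sumr sumrB pq subrr mulr0 addr0.
Qed.

Definition level_prob (c l : R) : R := Num.min 1 (l / c).

Lemma level_prob_gt0 c l : 0 < c -> 0 < l -> 0 < level_prob c l.
Proof. by move=> c0 l0; rewrite lt_min ltr01 divr_gt0. Qed.

Lemma level_prob_le1 c l : level_prob c l <= 1.
Proof. by rewrite ge_min lexx. Qed.

Lemma level_prob_lt1 c l : level_prob c l < 1 -> level_prob c l = l / c.
Proof. by rewrite /level_prob gt_min ltxx /= => lc; apply/min_idPr/ltW. Qed.

(** The function q |-> l^2 / q + c^2 q on ]0, 1] is minimal at min(1, l / c):
    below the level (l <= c) the difference is (l - c q)^2 / q, and above it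
    the function decreases on the whole interval. *)
Lemma level_prob_tangent c l q : 0 < c -> 0 < l -> 0 < q -> q <= 1 ->
  l ^+ 2 / level_prob c l + c ^+ 2 * (level_prob c l - q) <= l ^+ 2 / q.
Proof.
move=> c0 l0 q0 q1.
have [lc|cl] := leP l c; rewrite -subr_ge0.
  have -> : level_prob c l = l / c.
    by apply/min_idPr; rewrite ler_pdivrMr // mul1r.
  have -> : l ^+ 2 / q - (l ^+ 2 / (l / c) + c ^+ 2 * (l / c - q))
    = (l - c * q) ^+ 2 / q by field; rewrite !gt_eqF.
  by rewrite divr_ge0 ?sqr_ge0 // ltW.
have -> : level_prob c l = 1.
  by apply/min_idPl; rewrite ler_pdivlMr // mul1r ltW.
have -> : l ^+ 2 / q - (l ^+ 2 / 1 + c ^+ 2 * (1 - q))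
  = (1 - q) * (l ^+ 2 - c ^+ 2 * q) / q by field; rewrite gt_eqF.
rewrite divr_ge0 ?mulr_ge0 ?subr_ge0 ?(ltW q0) //.
have : c ^+ 2 <= l ^+ 2 by rewrite ler_sqr ?nnegrE ltW.
have c20 := sqr_ge0 c; nra.
Qed.

(** The exact slack of [level_prob_tangent] at q = 1, for l below the level. *)
Lemma level_prob_gap c l : 0 < c -> 0 < l -> level_prob c l < 1 ->
  l ^+ 2 / level_prob c l + c ^+ 2 * (level_prob c l - 1)
    + l ^+ 2 * ((level_prob c l)^-1 - 1) ^+ 2 = l ^+ 2.
Proof.
move=> c0 l0 /level_prob_lt1->.
by field; rewrite !gt_eqF.
Qed.

Variables (n : nat) (L : 'I_n -> R) (b : R).
Hypotheses (L_gt0 : forall i, 0 < L i)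
  (L_homo : {homo L : i j / (i <= j)%N >-> i <= j})
  (b_gt0 : 0 < b) (b_le : b <= n%:R).

Let n_gt0 : (0 < n)%N.
Proof. by rewrite -(ltr_nat R) (lt_le_trans b_gt0). Qed.

(** * Cutoffs *)

(** The term L_j alone makes the upper bound at least 1. *)
Lemma cutoff_first (j : 'I_n) : 0 < b + j.+1%:R - n%:R ->
  b + j.+1%:R - n%:R <= 1 -> cutoff L b j.
Proof.
move=> bj bj1; rewrite /cutoff bj /= (le_trans bj1) // ler_pdivlMr // mul1r.
by rewrite (bigD1 j) //= lerDl sumr_ge0 // => i _; rewrite ltW.
Qed.

(** The first index at which b + j - n becomes positive is a cutoff, as that
    quantity then lies in ]0, 1]. *)
Lemma ex_largest_cutoff : exists k : 'I_n, largest_cutoff L b k.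
Proof.
pose P (j : 'I_n) := 0 < b + j.+1%:R - n%:R
  <= (\sum_(i < n | (i <= j)%N) L i) / L j.
have [j Pj] : exists j, P j.
  pose Q m := (m < n)%N && (0 < b + m.+1%:R - n%:R).
  have exQ : exists m, Q m.
    by exists n.-1; rewrite /Q prednK // leqnn addrK.
  case: (ex_minnP exQ) => m /andP[mn bm] minm.
  exists (Ordinal mn); apply: cutoff_first => //=.
  (* For the very first index the bound by 1 comes from b <= n instead of
     minimality. *)
  case: m mn bm minm => [|m] mn bm minm; first by rewrite lerBlDr addrC lerD2l.
  rewrite -natr1; suff : b + m.+1%:R - n%:R <= 0 by lra.
  rewrite leNgt; apply/negP => bm'.
  by have := minm m; rewrite /Q (ltnW mn) bm' ltnn => /(_ isT).
case: (@arg_maxnP _ j P val Pj) => k Pk maxk.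
by exists k; split=> // i; apply: maxk.
Qed.

Lemma integer_cutoff (m : nat) (j : 'I_n) :
  b = m%:R -> j = (n - m)%N :> nat -> cutoff L b j.
Proof.
move=> bm jE; have mn : (m <= n)%N by rewrite -(ler_nat R) -bm.
by apply: cutoff_first; rewrite jE -natr1 natrB // bm; lra.
Qed.

(** * Values of alpha *)

Lemma alpha_le S v S' v' : minibatch S = b -> minibatch S' = b ->
  \sum_i v i * L i ^+ 2 / marginal S i
    <= \sum_i v' i * L i ^+ 2 / marginal S' i ->
  alpha L S v <= alpha L S' v'.
Proof.
move=> Sb S'b le_sum; rewrite /alpha /Kconst Sb S'b ler_wpM2r ?invr_ge0 ?sqr_ge0 //.
by rewrite ler_wpM2l // divr_ge0 ?sqr_ge0 // ltW.
Qed.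

Lemma sum_const_below (m : nat) (x : R) : (m <= n)%N ->
  \sum_(i < n | (i < m)%N) x = m%:R * x.
Proof. by move=> mn; rewrite (big_ord_narrow mn) sumr_const card_ord mulr_natl. Qed.

Lemma sum_one_above (m : nat) (F : 'I_n -> R) : (m <= n)%N ->
  \sum_(i < n) (if (i < m)%N then F i else 1)
    = \sum_(i < n | (i < m)%N) F i + (n%:R - m%:R).
Proof.
move=> mn; have -> : n%:R - m%:R = \sum_(i < n | ~~ (i < m)%N) 1 :> R.
  have <- : \sum_(i < n) (1 : R) = n%:R by rewrite sumr_const card_ord.
  rewrite (bigID (fun i : 'I_n => (i < m)%N)) /= sum_const_below // mulr1.
  by rewrite addrAC subrr add0r.
rewrite (bigID (fun i : 'I_n => (i < m)%N)) /=; congr (_ + _).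
  by apply: eq_bigr => i ->.
by apply: eq_bigr => i /negbTE->.
Qed.

(** The budget forces b + m - n = (sum_{i < m} L_i) / c, whence the closed
    form.  The threshold m is a parameter because the independent sampling uses
    the cutoff k and the approximate one uses [approx_k p], which is smaller
    when p_k = 1. *)
Lemma alpha_valueE S v p (c : R) (m : nat) (s : R) : (m <= n)%N -> c != 0 ->
  minibatch S = b -> marginal S =1 p -> \sum_i p i = b ->
  (forall i : 'I_n, p i = if (i < m)%N then L i / c else 1) ->
  (forall i : 'I_n, v i = if (i < m)%N then 1 - p i * s else 0) ->
  alpha L S v = alpha_value L b m s.
Proof.
move=> mn c0 Sb Sp pb pE vE; rewrite /alpha /alpha_value; congr (_ / _).
have -> : b + m%:R - n%:R = (\sum_(i < n | (i < m)%N) L i) / c.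
  rewrite -pb (eq_bigr _ (fun i _ => pE i)) sum_one_above // -mulr_suml.
  by ring.
set A := \sum_(i < n | _) L i; set Q := \sum_(i < n | _) _.
rewrite /Kconst Sb.
have -> : \sum_i v i * L i ^+ 2 / marginal S i = c * A - s * Q.
  rewrite (bigID (fun i : 'I_n => (i < m)%N)) /= addrC big1 => [|i /negbTE im].
    rewrite add0r !mulr_sumr -sumrB; apply: eq_bigr => i im.
    have Li := gt_eqF (L_gt0 i).
    by rewrite Sp vE pE im; field; rewrite c0 Li.
  by rewrite vE im !mul0r.
(* A = 0 happens for m = 0 only; the first term of alpha_value is then 0 / 0 = 0. *)
have [->|A0] := eqVneq A 0; first by rewrite expr2 !mul0r !mulr0; ring.
by field; rewrite A0 c0 pnatr_eq0 -lt0n n_gt0.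
Qed.

(** * The optimal probabilities *)

Section OptimalProbabilities.
Variables (k : 'I_n) (k_cut : largest_cutoff L b k).

Let p := opt_probs L b k.
Let A := \sum_(i < n | (i <= k)%N) L i.
Let bk_gt0 : 0 < b + k.+1%:R - n%:R.
Proof. by case: k_cut => /andP[]. Qed.

Let c := A / (b + k.+1%:R - n%:R).

Let A_gt0 : 0 < A.
Proof.
by rewrite /A (bigD1 k) //= ltr_pwDl // sumr_ge0 // => i _; rewrite ltW.
Qed.

Let c_gt0 : 0 < c. Proof. exact: divr_gt0. Qed.

Lemma L_le_level (i : 'I_n) : (i <= k)%N -> L i <= c.
Proof.
move=> ik; apply: le_trans (L_homo ik) _.
case: k_cut => /andP[_ le_k] _.
by rewrite /c ler_pdivlMr // mulrC -ler_pdivlMr.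
Qed.

(** With A the sum of L_1, ..., L_k, suppose that L_{k+1} < c = A / (b + k - n).
    Then L_{k+1} (b + k - n) < A, and adding L_{k+1} to both sides gives the
    cutoff condition for k + 1, against the maximality of k. *)
Lemma level_le_L (i : 'I_n) : (k < i)%N -> c <= L i.
Proof.
move=> ki; have kn : (k.+1 < n)%N := leq_ltn_trans ki (ltn_ord i).
apply: le_trans (L_homo (ki : (Ordinal kn <= i)%N)).
set j := Ordinal kn.
rewrite /c ler_pdivrMr // leNgt; apply/negP => Lj.
suff /(proj2 k_cut) : cutoff L b j by rewrite ltnn.
have Sj : \sum_(i0 < n | (i0 <= j)%N) L i0 = A + L j.
  rewrite (bigD1 j) //= addrC; congr (_ + _); apply: eq_bigl => i0.
  by rewrite andbC -val_eqE -ltn_neqAle ltnS.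
have Dj : b + j.+1%:R - n%:R = b + k.+1%:R - n%:R + 1.
  by rewrite -[j.+1%:R]natr1 /=; ring.
rewrite /cutoff Dj Sj; apply/andP; split; first by rewrite addr_gt0.
rewrite ler_pdivlMr // mulrDl mul1r lerD2r mulrC ltW //.
Qed.

Lemma opt_probs_level i : p i = level_prob c (L i).
Proof.
rewrite /p /opt_probs -/A /level_prob; case: leqP => ik.
  have /min_idPr -> : L i / c <= 1 by rewrite ler_pdivrMr // mul1r L_le_level.
  by rewrite /c invf_div mulrCA.
by have /min_idPl -> : 1 <= L i / c by rewrite ler_pdivlMr // mul1r level_le_L.
Qed.

Lemma opt_probsE i : p i = if (i < k.+1)%N then L i / c else 1.
Proof.
rewrite /p /opt_probs -/A ltnS; case: ifP => // _.
by rewrite /c invf_div mulrCA.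
Qed.

Lemma sum_opt_probs : \sum_i p i = b.
Proof.
rewrite (eq_bigr _ (fun i _ => opt_probsE i)) sum_one_above //.
rewrite -mulr_suml -/A.
have -> : A / c = b + k.+1%:R - n%:R by rewrite /c invf_div mulrCA divff ?gt_eqF // mulr1.
by ring.
Qed.

Lemma opt_probs_sorted : sorted_probs b p.
Proof.
split; last exact: sum_opt_probs.
  by move=> i; rewrite opt_probs_level level_prob_gt0 ?level_prob_le1.
move=> i j ij; rewrite !opt_probs_level /level_prob le_min !ge_min lexx /=.
by rewrite ler_pM2r ?invr_gt0 // L_homo // orbT.
Qed.

Lemma alpha_indep_opt :
  alpha L (indep_sampling p) (indep_v p) = alpha_value L b k.+1 1.
Proof.
have [_ _ Sb _] := indep_admissible opt_probs_sorted.
apply: (alpha_valueE _ _ Sb (indep_marginal p) sum_opt_probs opt_probsE) => //.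
  by rewrite gt_eqF.
move=> i; rewrite /indep_v mulr1; case: ifPn => // ik.
by rewrite opt_probsE (negbTE ik) subrr.
Qed.

Lemma alpha_approx_opt :
  alpha L (approx_sampling p) (approx_v p)
    = alpha_value L b (approx_k p) (approx_s p).
Proof.
have sp := opt_probs_sorted; have [_ _ Sb _] := approx_admissible sp.
apply: (alpha_valueE (c := c) _ _ Sb (approx_marginal sp) sum_opt_probs) => //.
- exact: approx_k_le.
- by rewrite gt_eqF.
move=> i; rewrite (ltn_approx_k sp) opt_probs_level.
case: ifPn => [/level_prob_lt1 //|]; rewrite -leNgt => p1.
by apply/eqP; rewrite eq_le level_prob_le1.
Qed.

Lemma approx_k_opt : p k < 1 -> approx_k p = k.+1.
Proof.
have sp := opt_probs_sorted => pk1; apply/eqP; rewrite eqn_leq.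
rewrite (ltn_approx_k sp) pk1 andbT.
rewrite leqNgt; apply/negP => kk.
have kn := leq_trans kk (approx_k_le p).
have := ltn_approx_k sp (Ordinal kn); rewrite kk /= => /esym.
by rewrite opt_probsE /= ltnn ltxx.
Qed.

(** The lower bound v_i >= 1 - p_i reduces an arbitrary admissible pair to the
    separable convex problem. *)
Lemma indep_opt_min S v : admissible b S v ->
  alpha L (indep_sampling p) (indep_v p) <= alpha L S v.
Proof.
case=> Slaw Sprop Sb Seso.
have [_ _ Ib _] := indep_admissible opt_probs_sorted.
apply: alpha_le => //.
apply: (@ler_sum_multiplier _ _ _ p (marginal S) (c ^+ 2)).
  by rewrite sum_opt_probs -Sb minibatch_marginal.
move=> i; rewrite indep_marginal /indep_v.
have q0 := Sprop i; have q1 := marginal_le1 i Slaw.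
have := level_prob_tangent c_gt0 (L_gt0 i) q0 q1; rewrite -opt_probs_level => tan.
have p0 : 0 < p i by rewrite opt_probs_level level_prob_gt0.
apply: le_trans (_ : (1 - marginal S i) * L i ^+ 2 / marginal S i <= _).
  have Ep x : x != 0 -> (1 - x) * L i ^+ 2 / x = L i ^+ 2 / x - L i ^+ 2.
    by move=> x0; field.
  rewrite !Ep ?gt_eqF //; lra.
rewrite ler_wpM2r ?invr_ge0 ?(ltW q0) // ler_wpM2r ?sqr_ge0 //.
exact: eso_lower_bound.
Qed.

(** Termwise comparison.  Where p_i = 1, or where p_i and q_i are both below 1,
    the extra term (1 - s) L_i^2 is no larger for p and the tangent inequality
    is enough.  Where p_i < 1 = q_i the extra term is present for p only, and
    the slack of the tangent inequality pays for it. *)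
Lemma approx_opt_min q : sorted_probs b q -> approx_s q <= approx_s p ->
  alpha L (approx_sampling p) (approx_v p)
    <= alpha L (approx_sampling q) (approx_v q).
Proof.
move=> sq les; have sp := opt_probs_sorted.
have [_ _ Pb _] := approx_admissible sp; have [_ _ Qb _] := approx_admissible sq.
apply: alpha_le => //.
apply: (@ler_sum_multiplier _ _ _ p q (c ^+ 2)).
  by rewrite sum_opt_probs; case: sq.
have termE r i : sorted_probs b r ->
  approx_v r i * L i ^+ 2 / marginal (approx_sampling r) i
    = L i ^+ 2 / r i - L i ^+ 2 + (if r i < 1 then (1 - approx_s r) * L i ^+ 2 else 0).
  move=> sr; have [/(_ i)/andP[r0 r1] _ _] := sr.
  rewrite (approx_marginal sr) /approx_v (ltn_approx_k sr).
  case: ifPn => [_|]; first by field; rewrite gt_eqF.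
  rewrite -leNgt => r1'; have -> : r i = 1 by apply/eqP; rewrite eq_le r1.
  by field.
move=> i; rewrite !termE //.
have [/(_ i)/andP[q0 q1] _ _] := sq.
have := level_prob_tangent c_gt0 (L_gt0 i) q0 q1; rewrite -opt_probs_level => tan.
have dp := one_sub_approx_s_ge0 sp; have L2 := sqr_ge0 (L i).
have dq : 0 <= approx_s p - approx_s q by rewrite subr_ge0.
have [pi1|] := ltP (p i) 1; last first.
  case: ifP => _ _; last by lra.
  have := mulr_ge0 (one_sub_approx_s_ge0 sq) L2; lra.
have [qi1|qi1] := ltP (q i) 1.
  have := mulr_ge0 dq L2; lra.
have -> : q i = 1 by apply/eqP; rewrite eq_le q1.
have := level_prob_gap c_gt0 (L_gt0 i); rewrite -opt_probs_level => /(_ pi1) gap.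
have := ler_wpM2r L2 (one_sub_approx_s_le sp pi1).
rewrite divr1; lra.
Qed.

End OptimalProbabilities.

(** * Comparison with uniform sampling *)

Lemma alpha_unif (m : nat) : b = m%:R ->
  alpha L (unif_sampling R n m) (unif_v R n m)
    = (n%:R - b) * (n%:R / (n%:R - 1)) * ((\sum_i L i ^+ 2) / (\sum_i L i) ^+ 2).
Proof.
move=> bm; have [[_ _ Sb _] margE] := unif_admissible bm b_gt0 b_le.
rewrite /alpha /Kconst Sb.
have -> : \sum_i unif_v R n m i * L i ^+ 2 / marginal (unif_sampling R n m) i
  = (n%:R - b) / (n%:R - 1) * (n%:R / b) * \sum_i L i ^+ 2.
  rewrite mulr_sumr; apply: eq_bigr => i _; rewrite margE /unif_v -bm.
  by rewrite invf_div mulrAC.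
(* The inverse of n - 1 stays opaque, as n may be 1. *)
rewrite /Lbar; set Q := \sum_i _ ^+ 2; set A := \sum_i _; set w := (n%:R - 1)^-1.
have n0 : n%:R != 0 :> R by rewrite pnatr_eq0 -lt0n.
have A0 : A != 0 by rewrite gt_eqF ?(sum_L_gt0 n_gt0 L_gt0).
by field; rewrite n0 A0 gt_eqF.
Qed.

Lemma largest_cutoff_full (k l : 'I_n) : largest_cutoff L b k ->
  l.+1 = n -> b * L l <= \sum_i L i -> k.+1 = n.
Proof.
move=> [_ maxk] ln bl; apply/eqP; rewrite eqn_leq ltn_ord -[X in (X <= _)%N]ln ltnS.
apply: maxk; rewrite /cutoff ln addrK b_gt0 ler_pdivlMr //=.
by rewrite [leRHS](eq_bigl xpredT) // => i; rewrite -ltnS ln ltn_ord.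
Qed.

Lemma alpha_value_full : alpha_value L b n 1
  = 1 - b * ((\sum_i L i ^+ 2) / (\sum_i L i) ^+ 2).
Proof.
have fullE (F : 'I_n -> R) : \sum_(i < n | (i < n)%N) F i = \sum_i F i.
  by apply: eq_bigl => i; rewrite ltn_ord.
rewrite /alpha_value addrK !fullE.
rewrite /Lbar; set Q := \sum_i _ ^+ 2; have := sum_L_gt0 n_gt0 L_gt0.
set A := \sum_i _ => A0; by field; rewrite !gt_eqF // ltr0n.
Qed.

End Optimization.

Theorem lemma2 (R : realType) (n : nat) (L : 'I_n -> R) (b : R)
    (L_gt0 : forall i, 0 < L i)
    (L_homo : {homo L : i j / (i <= j)%N >-> i <= j})
    (b_gt0 : 0 < b) (b_le : b <= n%:R) :
  (* the largest cutoff exists; for integer b, n - b + 1 is a cutoff *)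
  (exists k : 'I_n, largest_cutoff L b k) /\
  (forall (m : nat) (j : 'I_n), b = m%:R -> j = (n - m)%N :> nat ->
     cutoff L b j) /\
  (* the vectors v attached to S^u and S^a are admissible *)
  (forall m : nat, b = m%:R ->
     admissible b (unif_sampling R n m) (unif_v R n m)) /\
  (forall p : 'I_n -> R, sorted_probs b p ->
     admissible b (approx_sampling p) (approx_v p) /\
     marginal (approx_sampling p) =1 p) /\
  (forall k : 'I_n, largest_cutoff L b k ->
     let p := opt_probs L b k in
     sorted_probs b p /\
     (* (1) *)
     (admissible b (indep_sampling p) (indep_v p) /\
      marginal (indep_sampling p) =1 p /\
      forall (S : {set 'I_n} -> R) (v : 'I_n -> R), admissible b S v ->
        alpha L (indep_sampling p) (indep_v p) <= alpha L S v) /\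
     (* (2) *)
     ((forall q : 'I_n -> R, sorted_probs b q -> approx_s q <= approx_s p ->
         alpha L (approx_sampling p) (approx_v p)
           <= alpha L (approx_sampling q) (approx_v q)) /\
      alpha L (indep_sampling p) (indep_v p) = alpha_value L b k.+1 1 /\
      alpha L (approx_sampling p) (approx_v p)
        = alpha_value L b (approx_k p) (approx_s p) /\
      (p k < 1 -> approx_k p = k.+1)) /\
     (* (3) *)
     (forall l : 'I_n, l.+1 = n -> b * L l <= \sum_i L i ->
        k.+1 = n /\
        alpha L (indep_sampling p) (indep_v p)
          = 1 - b * ((\sum_i L i ^+ 2) / (\sum_i L i) ^+ 2) /\
        1 - b * ((\sum_i L i ^+ 2) / (\sum_i L i) ^+ 2)
          <= (n%:R - b) / n%:R /\
        forall m : nat, b = m%:R ->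
          alpha L (unif_sampling R n m) (unif_v R n m)
            = (n%:R - b) * (n%:R / (n%:R - 1))
              * ((\sum_i L i ^+ 2) / (\sum_i L i) ^+ 2)) /\
     (* (4) *)
     ((forall i j, L i = L j) ->
        alpha L (indep_sampling p) (indep_v p) = (n%:R - b) / n%:R /\
        forall m : nat, b = m%:R ->
          alpha L (unif_sampling R n m) (unif_v R n m)
            = (n%:R - b) / (n%:R - 1))).
Proof.
split; first exact: ex_largest_cutoff.
split; first by move=> m j; apply: integer_cutoff.
split; first by move=> m bm; case: (unif_admissible bm b_gt0 b_le).
split.
  by move=> p sp; split; [exact: approx_admissible | exact: approx_marginal sp].
move=> k kcut; set p := opt_probs L b k.
have sp : sorted_probs b p by apply: opt_probs_sorted.
have alphaE : alpha L (indep_sampling p) (indep_v p) = alpha_value L b k.+1 1.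
  exact: alpha_indep_opt.
have full (l : 'I_n) : l.+1 = n -> b * L l <= \sum_i L i ->
    k.+1 = n /\ alpha L (indep_sampling p) (indep_v p)
      = 1 - b * ((\sum_i L i ^+ 2) / (\sum_i L i) ^+ 2).
  move=> ln bl; have kn := largest_cutoff_full L_gt0 b_gt0 kcut ln bl.
  by split=> //; rewrite alphaE kn alpha_value_full.
have n0 : 0 < n%:R :> R by apply: lt_le_trans b_le.
have n_gt0 : (0 < n)%N by rewrite -(ltr_nat R).
split=> //; split.
  split; first exact: indep_admissible.
  split; first exact: indep_marginal.
  by move=> S v; apply: indep_opt_min.
split.
  split; first by move=> q; apply: approx_opt_min.
  split; first exact: alphaE.
  by split; [exact: alpha_approx_opt | apply: approx_k_opt].
split.
  move=> l ln bl; have [kn aE] := full l ln bl.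
  split=> //; split=> //; split; last by move=> m; apply: alpha_unif.
  by rewrite mulrBl divff ?gt_eqF // lerD2l lerN2 ler_pM2l // sum_sqr_ratio_ge.
move=> Lc; have ratio := sum_sqr_ratio_const n_gt0 L_gt0 Lc.
have lt_l : (n.-1 < n)%N by rewrite prednK.
split.
  have [||_ ->] := full (Ordinal lt_l); first by rewrite /= prednK.
    rewrite (eq_bigr (fun=> L (Ordinal lt_l))) // sumr_const card_ord -mulr_natl.
    by rewrite ler_wpM2r // ltW.
  by rewrite ratio mulrBl divff ?gt_eqF.
move=> m bm; rewrite (alpha_unif L_gt0 b_gt0 b_le bm) ratio -mulrA mulrAC divff ?gt_eqF //.
by rewrite mul1r.
Qed.
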